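(* Let $d>1$ be an integer and let $r$ be a positive integer with $r<d$. Let $(\mathcal{T}_t)_{t\ge 0}$ be the random $d$-ary recursive tree process and let $S_t$ be the number of vertices of a largest $r$-ary subtree of $\mathcal{T}_t$. Then there exists a fixed (deterministic) $\delta<1$ such that $S_t<t^{\delta}$ eventually (for large $t$).
   Context: Random $d$-ary recursive tree process: at time $0$ the tree $\mathcal{T}_0$ consists of exactly one vertex, the root. In the first step the root gives birth to $d$ offspring. In each subsequent step a vertex with no offspring is picked uniformly at random (given the past) and given exactly $d$ newly created offspring. $\mathcal{T}_t$ denotes the tree after $t$ steps. An $r$-ary subtree is a connected subgraph (subtree) of the rooted tree in which every vertex has at most $r$ offspring. A sequence of events $\{A_k, k\in\mathbb{N}\}$ occurs eventually (for large $k$) if there exists an almost surely finite random variable $N$ such that $A_k$ occurs for all $k\ge N$. *)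

(* Defs.v *)
From mathcomp Require Import all_boot all_order all_algebra finmap.
From mathcomp Require Import all_classical all_reals all_analysis measurable_realfun.

Set Implicit Arguments.
Unset Strict Implicit.
Unset Printing Implicit Defensive.

Import Order.TTheory GRing.Theory Num.Theory.

Local Open Scope classical_set_scope.
Local Open Scope ring_scope.

(* Ulam-Harris words: [::] is the root, and the offspring of v are the d words
   rcons v i.  A tree is represented by its set of vertices. *)
Definition vertex (d : nat) := seq 'I_d.
Definition tree (d : nat) := {fset vertex d}.

Definition root_tree (d : nat) : tree d := [fset ([::] : vertex d)]%fset.

Definition offspring (d : nat) (v : vertex d) : tree d :=
  [fset rcons v i | i in 'I_d]%fset.

Definition leaves (d : nat) (tau : tree d) : {fset vertex d} :=
  [fset v in tau | (offspring v `&` tau)%fset == fset0]%fset.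

Definition grow (d : nat) (tau : tree d) (v : vertex d) : tree d :=
  (tau `|` offspring v)%fset.

Definition adjacent_vertices (d : nat) (u v : vertex d) : bool :=
  (v \in offspring u) || (u \in offspring v).

(* A connected subgraph of a tree contains every edge of the tree between two
   of its vertices, so subtrees are identified with their vertex sets. *)
Definition connected_vertices (d : nat) (U : tree d) : bool :=
  [forall u : U, forall v : U,
    connect (fun x y : U => adjacent_vertices (val x) (val y)) u v].

(* A subtree need not contain the root of the ambient tree. *)
Definition r_ary_subtree (d r : nat) (tau U : tree d) : bool :=
  [&& (U `<=` tau)%fset, U != fset0, connected_vertices U &
      [forall v : U, (#|` (offspring (val v) `&` U)%fset| <= r)%N]].

Definition largest_r_ary (d r : nat) (tau : tree d) : nat :=
  \max_(U <- fpowerset tau | r_ary_subtree r tau U) #|` U|.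

(* Tr t is the tree after t steps and V t the vertex picked in step t.+1.  The
   past of step t.+1 is the tree history Tr 0, ..., Tr t, which determines the
   picks V 0, ..., V t.-1.  The conditional law of V t is written as a product,
   so that histories of probability 0 impose nothing.  In the first step the
   only leaf is the root. *)
Record recursive_tree_process (R : realType) (disp : measure_display)
    (Omega : measurableType disp) (P : probability Omega R) (d : nat)
    (Tr : nat -> Omega -> tree d) (V : nat -> Omega -> vertex d) : Prop :=
  RecursiveTreeProcess {
    tree_measurable : forall t tau, measurable [set w | Tr t w = tau] ;
    pick_measurable : forall t v, measurable [set w | V t w = v] ;
    tree_initial : forall w, Tr 0%N w = root_tree d ;
    pick_leaf : forall t w, V t w \in leaves (Tr t w) ;
    tree_step : forall t w, Tr t.+1 w = grow (Tr t w) (V t w) ;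
    pick_uniform : forall (t : nat) (tau : nat -> tree d) (v : vertex d),
      v \in leaves (tau t) ->
      let past := [set w | forall s, (s <= t)%N -> Tr s w = tau s] in
      (P (past `&` [set w | V t w = v]) =
       P past * ((#|` leaves (tau t)|%:R : R)^-1)%:E)%E
  }.

Definition occurs_eventually (R : realType) (disp : measure_display)
    (Omega : measurableType disp) (P : probability Omega R)
    (A : nat -> set Omega) : Prop :=
  exists N : Omega -> \bar R,
    [/\ measurable_fun setT N,
        {ae P, forall w, N w \is a fin_num} &
        forall (k : nat) (w : Omega), (N w <= (k%:R : R)%:E)%E -> A k w].

(* Main.v *)
Require Import Defs.
From mathcomp Require Import all_boot all_order all_algebra finmap.
From mathcomp Require Import all_classical all_reals all_analysis measurable_realfun.
From mathcomp Require Import ring lra zify.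

Set Implicit Arguments.
Unset Strict Implicit.
Unset Printing Implicit Defensive.

Import Order.TTheory GRing.Theory Num.Theory.

Local Open Scope classical_set_scope.
Local Open Scope ring_scope.

(** Why the theorem holds.  Cut the tree at its root.  The d subtrees of the
    offspring of the root, given their sizes, are independent recursive trees,
    and an r-ary subtree misses at least one of them because r < d.  Hence, if F
    is the largest size and F_1, ..., F_d are its values on the d subtrees,

      F <= 1 + (F_1 + ... + F_d) - min_i F_i.

    To make this recursion clean, F is the maximum of #|U| over the larger class
    of sets U that below every vertex leave one of the d branches empty
    ([largest_avoiding], [largest_avoiding_children]); r-ary subtrees belong to
    this class ([r_ary_avoiding]).

    The bound is obtained for the second moment, by induction on the number n of
    steps: E F^2 <= (K l^delta)^2, where l = (d - 1) n + 1 is the number of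
    leaves.  The number of leaves is additive over the d subtrees, so with
    delta = 1 the sum F_1 + ... + F_d alone would reproduce the bound exactly.
    Subtracting the minimum gains a fixed proportion of it
    ([second_moment_sum_drop_min]), for the following reason.  If the mean of
    some F_i is at most half of the bound on its L2 norm, then the cross terms
    E F_i E F_j are small.  Otherwise each F_i is of the order of its bound with
    positive probability, by a Paley-Zygmund argument, and by independence so is
    the minimum.  The gain is proportional to the square of the smallest
    relative size of the d subtrees, hence at least to the square of the product
    of the relative sizes.  Under the Polya urn that governs the sizes, the
    product of the numbers of leaves is multiplied in mean by an explicit factor
    at each step, so the expected product of the relative sizes stays away from
    0 ([urn_mean_leaf_prod_ge]).  Therefore the induction leaves room for some
    delta < 1 ([largest_avoiding_second_moment]).

    Finally, Chebyshev's inequality at the times 2^k, the Borel-Cantelli lemma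
    and the monotonicity of the size in time turn the moment bound into an
    almost sure statement, at the cost of a slightly larger exponent.

    Expectations under the law of the tree are computed without measure theory,
    as normalised sums over histories ([mean]); [law_mean] identifies them with
    probabilities. *)

(** * Vertices, leaves and branches *)

Lemma mem_offspring d (v u : vertex d) :
  reflect (exists i, u = rcons v i) (u \in offspring v).
Proof.
by apply: (iffP (imfsetP _ _ _ _)) => [[i _ ->]|[i ->]]; exists i.
Qed.

Lemma rcons_offspring d (v : vertex d) i : rcons v i \in offspring v.
Proof. by apply/mem_offspring; exists i. Qed.

Lemma offspring_inj d (u v w : vertex d) :
  w \in offspring u -> w \in offspring v -> u = v.
Proof.
by move=> /mem_offspring[i ->] /mem_offspring[j /rcons_inj[]].
Qed.

Lemma card_offspring d (v : vertex d) : #|` offspring v| = d.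
Proof.
by rewrite card_imfset /=; [rewrite -cardE card_ord|exact: rcons_injr].
Qed.

Lemma mem_leaves d (tau : tree d) v :
  reflect (v \in tau /\ forall i, rcons v i \notin tau) (v \in leaves tau).
Proof.
rewrite !inE /=; apply: (iffP andP) => -[vt].
  move=> /eqP e; split=> // i; apply/negP => it.
  by have := in_fset0 (rcons v i); rewrite -e inE rcons_offspring it.
move=> h; split=> //; apply/eqP/fsetP => u; rewrite inE in_fset0.
by apply/negP => /andP[/mem_offspring[i ->]]; rewrite (negPf (h i)).
Qed.

Lemma mem_grow d (tau : tree d) v u :
  (u \in grow tau v) = (u \in tau) || (u \in offspring v).
Proof. by rewrite inE. Qed.

(** The branch of [tau] below the offspring [i] of the root, seen as a tree of
    its own. *)
Definition child d (i : 'I_d) (tau : tree d) : tree d :=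
  [fset behead v | v in [fset v in tau | ohead v == Some i]]%fset.

Lemma mem_child d (i : 'I_d) tau v : (v \in child i tau) = (i :: v \in tau).
Proof.
apply/imfsetP/idP => [[[|j w]]|h]; rewrite ?inE //=.
- by rewrite andbF.
- by move=> /andP[jw /eqP[<-]] ->.
- by exists (i :: v); rewrite // !inE h /=.
Qed.

Lemma leaves_child d (i : 'I_d) tau v :
  (v \in leaves (child i tau)) = (i :: v \in leaves tau).
Proof.
apply/mem_leaves/mem_leaves; rewrite mem_child => -[h1 h2].
  by split=> // j; have := h2 j; rewrite mem_child.
by split=> // j; rewrite mem_child; exact: h2.
Qed.

Lemma child_grow d (i j : 'I_d) tau v :
  child j (grow tau (i :: v)) =
    if j == i then grow (child j tau) v else child j tau.
Proof.
apply/fsetP => u; rewrite mem_child mem_grow.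
have -> : (j :: u \in offspring (i :: v)) = (j == i) && (u \in offspring v).
  apply/mem_offspring/andP => [[k [-> ->]]|[/eqP -> /mem_offspring[k ->]]].
    by rewrite eqxx rcons_offspring.
  by exists k.
by case: eqP => _; rewrite ?mem_grow mem_child ?orbF.
Qed.

Lemma child_grow_root d (i : 'I_d) :
  child i (grow (root_tree d) [::]) = root_tree d.
Proof.
apply/fsetP => u; rewrite mem_child mem_grow !inE /=.
apply/mem_offspring/eqP => [[j [_ ->]]//|->]; by exists i.
Qed.

Lemma leaves_root d : leaves (root_tree d) = [fset [::]]%fset.
Proof.
apply/fsetP => u; apply/mem_leaves/fset1P => [[/fset1P]//|->].
by split=> [|i]; rewrite ?inE.
Qed.

Lemma root_not_leaf_grow d (tau : tree d) v :
  [::] \notin leaves tau -> [::] \notin leaves (grow tau v).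
Proof.
apply: contra => /mem_leaves[]; rewrite mem_grow.
have -> : ([::] \in offspring v) = false.
  by apply/mem_offspring => -[i]; case: (v).
rewrite orbF => h1 h2; apply/mem_leaves; split => // i.
by have := h2 i; rewrite mem_grow negb_or => /andP[].
Qed.

Lemma root_not_leaf_grow_root d : (0 < d)%N ->
  [::] \notin leaves (grow (root_tree d) [::]).
Proof.
move=> d0; apply/mem_leaves => -[_ /(_ (Ordinal d0))].
by rewrite mem_grow rcons_offspring orbT.
Qed.

Definition prefix_closed d (tau : tree d) :=
  forall v i, rcons v i \in tau -> v \in tau.

Lemma prefix_closed_root d : prefix_closed (root_tree d).
Proof. by move=> v i; rewrite !inE; case: v. Qed.

Lemma prefix_closed_grow d (tau : tree d) v :
  prefix_closed tau -> v \in leaves tau -> prefix_closed (grow tau v).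
Proof.
move=> pc /mem_leaves[vt _] u i; rewrite !mem_grow => /orP[/pc -> //|].
by move=> /mem_offspring[j /rcons_inj[-> _]]; rewrite vt.
Qed.

(** Prefix closure ensures that the new vertices are leaves: none of them can
    have offspring already present. *)
Lemma card_leaves_grow d (tau : tree d) v : (0 < d)%N ->
  prefix_closed tau -> v \in leaves tau ->
  (#|` leaves (grow tau v)| = #|` leaves tau| + d.-1)%N.
Proof.
move=> d0 pc vl; have /mem_leaves[vt vn] := vl.
have -> : leaves (grow tau v) = ((leaves tau `\ v) `|` offspring v)%fset.
  apply/fsetP => u; rewrite inE in_fsetD1.
  apply/mem_leaves/orP; rewrite mem_grow.
    move=> [ut un].
    have [|uv] := eqVneq u v.
      move=> uv; have := un (Ordinal d0).
      by rewrite mem_grow uv rcons_offspring orbT.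
    move: ut => /orP[ut|uo]; [left|by right].
    apply/mem_leaves; split => // i.
    by have := un i; rewrite mem_grow negb_or => /andP[].
  move=> [/andP[uv /mem_leaves[ut un]]|uo].
    rewrite ut; split=> // i; rewrite mem_grow negb_or un /=.
    by apply/negP => /(offspring_inj (rcons_offspring _ _)) /eqP; rewrite (negPf uv).
  rewrite uo orbT; split=> // i; move: uo => /mem_offspring[j ->].
  rewrite mem_grow negb_or; apply/andP; split.
    by apply/negP => /pc; rewrite (negPf (vn j)).
  apply/negP => /(offspring_inj (rcons_offspring _ _)) /(congr1 size) /eqP.
  by rewrite size_rcons -[X in _ == X]addn0 -addn1 eqn_add2l.
have dis : ((leaves tau `\ v) `&` offspring v = fset0)%fset.
  apply/fsetP => u; rewrite in_fsetI in_fset0 in_fsetD1.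
  apply/negP => /andP[/andP[_ /mem_leaves[ut _]] /mem_offspring[i e]].
  by move: ut; rewrite e (negPf (vn i)).
rewrite cardfsU dis cardfs0 subn0 card_offspring.
have := cardfsD1 v (leaves tau); rewrite vl => ->.
by rewrite add1n addSn -addnS (prednK d0).
Qed.

(** Hence the trees at two consecutive times determine the pick between them. *)
Lemma grow_inj d (tau : tree d) u v : (0 < d)%N ->
  u \in leaves tau -> v \in leaves tau -> grow tau u = grow tau v -> u = v.
Proof.
move=> d0 /mem_leaves[_ hu] _ e.
have : rcons u (Ordinal d0) \in grow tau v.
  by rewrite -e mem_grow rcons_offspring orbT.
rewrite mem_grow (negPf (hu _)) /=.
exact: offspring_inj (rcons_offspring _ _).
Qed.

(** * Sets of vertices that leave a branch empty below every vertex *)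

(** Unlike connectedness, this property passes at once to the branches of [U],
    which is what a recursion at the root needs.  Here [v] ranges over all words,
    whether in [U] or not. *)
Definition avoiding d (U : tree d) :=
  forall v : vertex d, exists i : 'I_d, forall w, v ++ i :: w \notin U.

Definition largest_avoiding d (tau : tree d) : nat :=
  \max_(U <- fpowerset tau | `[< avoiding U >]) #|` U|.

(** This is how connectedness is used: a connected set with elements inside and
    outside a branch has to contain both ends of the edge above that branch. *)
Lemma crossing_edge d (v : vertex d) (i : 'I_d) (u u' : vertex d) :
  adjacent_vertices u u' ->
  prefix (rcons v i) u -> ~~ prefix (rcons v i) u' ->
  u = rcons v i /\ u' = v.
Proof.
move=> /orP[] /mem_offspring[j ->].
  by move=> /prefix_trans h /negP[]; apply: h; exact: prefix_rcons.
rewrite !prefixE size_rcons => /eqP h h'.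
have [lt|le] := ltnP (size v) (size u').
  case/negP: h'; apply/eqP; rewrite -[RHS]h -cats1 takel_cat//.
have : size (take (size v).+1 (rcons u' j)) = (size v).+1.
  by rewrite h size_rcons.
rewrite size_take size_rcons ltnS; case: ltnP => [|le2 [sz]]; first by rewrite ltnNge le.
move: h; rewrite take_oversize ?size_rcons ?sz// => h; split => //.
by have [] := rcons_inj h.
Qed.

(** If all d branches below [v] meet [U], then, as there are at least two, [U]
    has elements inside and outside each of them.  Connectedness makes [U] use
    the only edge out of each branch, so [v] is in [U] together with its d
    offspring, which are more than r. *)
Lemma r_ary_avoiding d r (tau U : tree d) : (1 < d)%N -> (r < d)%N ->
  r_ary_subtree r tau U -> avoiding U.
Proof.
move=> d1 rd /and4P[_ _ conU /forallP card] v.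
apply: contrapT => /forallNP H.
have {}H i : exists w, v ++ i :: w \in U.
  have /existsNP[w /negP] := H i; rewrite negbK => hw; by exists w.
have K i : v \in U /\ rcons v i \in U.
  have [j ji] : exists j, j != i.
    have [e|ne] := eqVneq i (Ordinal (ltnW d1)); last first.
      by exists (Ordinal (ltnW d1)); rewrite eq_sym.
    by exists (Ordinal d1); rewrite e.
  have [w hw] := H i; have [w' hw'] := H j.
  apply: contrapT => N.
  (* If the edge to v is missing, the branch is closed under adjacency in U. *)
  have cl : fingraph.closed (fun x y : U => adjacent_vertices (val x) (val y))
                   [pred x : U | prefix (rcons v i) (val x)].
    have C (x y : U) : adjacent_vertices (val x) (val y) ->
        prefix (rcons v i) (val x) -> prefix (rcons v i) (val y).
      move=> xy px; apply: contrapT => /negP py.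
      have [ex ey] := crossing_edge xy px py.
      by apply: N; rewrite -ex -ey; split; apply: fsvalP.
    move=> x y xy; rewrite !inE; apply/idP/idP; first exact: C.
    by apply: C; rewrite /adjacent_vertices orbC.
  have := forallP (forallP conU (FSetSub hw)) (FSetSub hw').
  move=> /(closed_connect cl); rewrite !inE /= -cat_rcons prefix_prefix.
  have -> : prefix (rcons v i) (v ++ j :: w') = false; last by [].
  apply/negP => /prefixP[s]; rewrite -cats1 -catA => /eqP.
  by rewrite eqseq_cat // eqxx /= eqseq_cons (negPf ji).
have vU := (K (Ordinal (ltnW d1))).1.
have := card (FSetSub vU); rewrite /= => {}card.
have sub : (offspring v `<=` offspring v `&` U)%fset.
  apply/fsubsetP => u /[dup] uo /mem_offspring[i e].
  by rewrite in_fsetI uo /= e (K i).2.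
have := fsubset_leq_card sub; rewrite card_offspring => /leq_trans/(_ card).
by rewrite leqNgt rd.
Qed.

Lemma largest_r_ary_le_avoiding d r (tau : tree d) : (1 < d)%N -> (r < d)%N ->
  (largest_r_ary r tau <= largest_avoiding tau)%N.
Proof.
move=> d1 rd; apply/bigmax_leqP_seq => U Ut /(r_ary_avoiding d1 rd) aU.
by apply: leq_bigmax_seq => //; exact/asboolP.
Qed.

Lemma largest_r_ary_mono d r (tau tau' : tree d) : (tau `<=` tau')%fset ->
  (largest_r_ary r tau <= largest_r_ary r tau')%N.
Proof.
move=> s; apply/bigmax_leqP_seq => U; rewrite fpowersetE => Ut h.
apply: leq_bigmax_seq; first by rewrite fpowersetE (fsubset_trans Ut).
move: h; rewrite /r_ary_subtree => /and4P[_ -> -> ->].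
by rewrite (fsubset_trans Ut).
Qed.

Lemma largest_avoiding_root d : (largest_avoiding (root_tree d) <= 1)%N.
Proof.
apply/bigmax_leqP_seq => U; rewrite fpowersetE => /fsubset_leq_card.
by rewrite cardfs1.
Qed.

Definition children d (tau : tree d) : seq (tree d) :=
  [seq child i tau | i <- enum 'I_d].

(** The sum of all entries but a smallest one, written as a maximum so that
    dropping any entry gives a lower bound. *)
Definition sum_drop_min (x : seq nat) : nat := \max_(y <- x) (sumn x - y).

Lemma card_children d (U : tree d) :
  (#|` U| <= 1 + \sum_(i <- enum 'I_d) #|` child i U|)%N.
Proof.
have sz : size (enum_fset U) = #|` U| by [].
pose s := [::] :: [seq i :: v | i <- enum 'I_d, v <- enum_fset (child i U)].
have := @uniq_leq_size _ (enum_fset U) s (fset_uniq _).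
rewrite /s /= size_allpairs_dep sumnE big_map add1n; apply => -[|i v] vU.
  by rewrite inE.
rewrite inE /=; apply/allpairsPdep; exists i, v.
by rewrite mem_enum; split => //; rewrite mem_child.
Qed.

(** An avoiding set leaves one branch at the root empty; it restricts to an
    avoiding set in each of the others. *)
Lemma largest_avoiding_children d (tau : tree d) :
  (largest_avoiding tau <=
     1 + sum_drop_min [seq largest_avoiding t | t <- children tau])%N.
Proof.
apply/bigmax_leqP_seq => U; rewrite fpowersetE => Ut /asboolP aU.
have [k hk] := aU [::].
have ck : child k U = fset0.
  by apply/fsetP => v; rewrite mem_child in_fset0; apply/negbTE/hk.
have le i : (#|` child i U| <= largest_avoiding (child i tau))%N.
  apply: leq_bigmax_seq.
    by rewrite fpowersetE; apply/fsubsetP => v; rewrite !mem_child => /(fsubsetP Ut).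
  by apply/asboolP => v; have [j hj] := aU (i :: v); exists j => w; rewrite mem_child hj.
apply: leq_trans (card_children U) _; rewrite leq_add2l.
set x := [seq _ | _ <- _].
have kx : largest_avoiding (child k tau) \in x.
  by apply/mapP; exists (child k tau) => //; apply: map_f; rewrite mem_enum.
apply: leq_trans (leq_bigmax_seq _ kx _) => //.
rewrite /x sumnE /children -map_comp big_enum big_map big_enum /=.
rewrite (bigD1 k) //= ck cardfs0 add0n.
by rewrite [X in (_ <= X - _)%N](bigD1 k) //= addKn leq_sum.
Qed.

(** * Means over histories of the tree *)

(** All expectations below are finite, so plain linearity on all functions is
    available. *)
Definition linear_functional (R : realType) (T : Type) (L : (T -> R) -> R) :=
  forall c f g, L (fun x => c * f x + g x) = c * L f + L g.

Lemma linear_functionalZD (R : realType) T (L : (T -> R) -> R) c f g :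
  linear_functional L -> L (fun x => c * f x + g x) = c * L f + L g.
Proof. exact. Qed.

Lemma linear_functionalD (R : realType) T (L : (T -> R) -> R) f g :
  linear_functional L -> L (fun x => f x + g x) = L f + L g.
Proof.
move=> Ll; rewrite -[in RHS](mul1r (L f)) -Ll.
by congr L; apply/funext => x; rewrite mul1r.
Qed.

Lemma linear_functional0 (R : realType) T (L : (T -> R) -> R) :
  linear_functional L -> L (fun=> 0) = 0.
Proof.
move=> Ll; have := linear_functionalD (fun=> 0) (fun=> 0) Ll.
under eq_fun do rewrite addr0.
by lra.
Qed.

Lemma linear_functionalZ (R : realType) T (L : (T -> R) -> R) c f :
  linear_functional L -> L (fun x => c * f x) = c * L f.
Proof.
move=> Ll; rewrite -[RHS]addr0 -(linear_functional0 Ll) -Ll.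
by congr L; apply/funext => x; rewrite addr0.
Qed.

Lemma linear_functional_sum (R : realType) T (L : (T -> R) -> R) I (s : seq I) f :
  linear_functional L ->
  L (fun x => \sum_(i <- s) f i x) = \sum_(i <- s) L (f i).
Proof.
move=> Ll; elim: s => [|i s ih].
  rewrite big_nil -[RHS](linear_functional0 Ll).
  by congr L; apply/funext => x; rewrite big_nil.
rewrite big_cons -ih -linear_functionalD//.
by congr L; apply/funext => x; rewrite big_cons.
Qed.

(** The unnormalised generator of the process: one term for each way of
    performing the next step.  Without the division by the number of leaves the
    generators of the d branches simply add up. *)
Definition grow_sum (R : realType) d (f : tree d -> R) (tau : tree d) : R :=
  \sum_(v <- leaves tau) f (grow tau v).

(** The number of leaves of a tree after [n] steps. *)
Definition leaf_count (d n : nat) : nat := (d.-1 * n).+1.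

(** The number of histories of length [n], that is of sequences of picks. *)
Definition history_count (d n : nat) : nat := \prod_(s < n) leaf_count d s.

(** The expectation of [f] at the tree after [n] steps, as the average of [f]
    over all histories, which are equally likely. *)
Definition mean (R : realType) d (n : nat) (f : tree d -> R) : R :=
  iter n (@grow_sum R d) f (root_tree d) / (history_count d n)%:R.

Lemma history_count_gt0 d n : (0 < history_count d n)%N.
Proof. by rewrite prodn_gt0. Qed.

Lemma history_countS d n :
  history_count d n.+1 = (history_count d n * leaf_count d n)%N.
Proof. by rewrite /history_count big_ord_recr. Qed.

Lemma iter_grow_sum_linear (R : realType) d n tau :
  linear_functional (fun f => iter n (@grow_sum R d) f tau).
Proof.
move=> c f g; elim: n tau => //= n ih tau.
rewrite /grow_sum big_distrr -big_split /=.
by apply: eq_bigr => v _; rewrite ih.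
Qed.

Lemma iter_grow_sum_le (R : realType) d n tau (f g : tree d -> R) :
  (forall t, f t <= g t) ->
  iter n (@grow_sum R d) f tau <= iter n (@grow_sum R d) g tau.
Proof. by move=> fg; elim: n tau => [|n ih] tau //=; exact: ler_sum. Qed.

Lemma mean_linear (R : realType) d n : linear_functional (@mean R d n).
Proof.
by move=> c f g; rewrite /mean iter_grow_sum_linear mulrDl mulrA.
Qed.

Lemma mean0 (R : realType) d (f : tree d -> R) : mean 0 f = f (root_tree d).
Proof. by rewrite /mean /history_count big_ord0 divr1. Qed.

Lemma mean_grow_sum (R : realType) d n (f : tree d -> R) :
  mean n (grow_sum f) = (leaf_count d n)%:R * mean n.+1 f.
Proof.
rewrite /mean -iterSr history_countS natrM invfM mulrCA; congr (_ * _).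
by rewrite mulrC divfK // pnatr_eq0.
Qed.

Lemma mean_le (R : realType) d n (f g : tree d -> R) :
  (forall t, f t <= g t) -> mean n f <= mean n g.
Proof.
move=> fg; rewrite ler_pM2r ?invr_gt0 ?ltr0n ?history_count_gt0 //.
exact: iter_grow_sum_le.
Qed.

Lemma iter_grow_sum1 (R : realType) d n (tau : tree d) : (0 < d)%N ->
  prefix_closed tau ->
  iter n (@grow_sum R d) (fun=> 1) tau =
    \prod_(s < n) (#|` leaves tau| + d.-1 * s)%:R.
Proof.
move=> d0; elim: n tau => [|n ih] tau pc; first by rewrite big_ord0.
rewrite iterS /grow_sum big_seq.
under eq_bigr => v vt.
  rewrite ih ?(card_leaves_grow d0 pc vt)//; last exact: prefix_closed_grow.
  under eq_bigr do rewrite -addnA -mulnS.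
  over.
rewrite -big_seq big_const_seq count_predT iter_addr_0 big_ord_recl /=.
by rewrite muln0 addn0 mulr_natl.
Qed.

Lemma mean1 (R : realType) d n : (0 < d)%N -> @mean R d n (fun=> 1) = 1 :> R.
Proof.
move=> d0; rewrite /mean iter_grow_sum1//; last exact: prefix_closed_root.
rewrite leaves_root cardfs1 /history_count natr_prod.
rewrite divff // -natr_prod pnatr_eq0 -lt0n; exact: history_count_gt0.
Qed.

(** * Independence of the branches given their sizes *)

(** The generator of a list of trees of which one, at one leaf, grows at each
    step. *)
Fixpoint children_grow_sum (R : realType) d (g : seq (tree d) -> R)
    (x : seq (tree d)) : R :=
  if x is t :: y then
    grow_sum (fun t' => g (t' :: y)) t +
    children_grow_sum (fun y' => g (t :: y')) y
  else 0.

(** The expectation of [g] at a list of independent random trees, the k-th of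
    which has made as many steps as the k-th entry of [l]. *)
Fixpoint product_mean (R : realType) d (l : seq nat)
    (g : seq (tree d) -> R) : R :=
  if l is n :: l' then
    mean n (fun t => product_mean l' (fun y => g (t :: y)))
  else g [::].

(** The unnormalised generator of the Polya urn: the k-th branch makes a step
    with a weight equal to its number of leaves. *)
Fixpoint urn_sum (R : realType) d (h : seq nat -> R) (l : seq nat) : R :=
  if l is n :: l' then
    (leaf_count d n)%:R * h (n.+1 :: l') + urn_sum d (fun k => h (n :: k)) l'
  else 0.

Lemma product_mean_linear (R : realType) d l :
  linear_functional (@product_mean R d l).
Proof.
elim: l => //= n l ih c f g; rewrite -mean_linear.
by congr mean; apply/funext => t; rewrite ih.
Qed.

Lemma mean_urn_sum (R : realType) d n l (h : tree d -> seq nat -> R) :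
  mean n (fun t => urn_sum d (h t) l) =
  urn_sum d (fun k => mean n (fun t => h t k)) l.
Proof.
elim: l h => [|m l ih] h /=.
  exact: linear_functional0 (@mean_linear R d n).
by rewrite mean_linear ih.
Qed.

(** The intertwining that carries the independence: averaging over independent
    trees of prescribed sizes turns a growth step of the list of trees into a
    step of the urn of their sizes. *)
Lemma product_mean_children_grow_sum (R : realType) d l
    (g : seq (tree d) -> R) :
  product_mean l (children_grow_sum g) =
  urn_sum d (fun k => product_mean k g) l.
Proof.
elim: l g => //= n l ih g.
transitivity (mean n (fun t =>
  grow_sum (fun t' => product_mean l (fun y => g (t' :: y))) t +
  urn_sum d (fun k => product_mean k (fun y => g (t :: y))) l)).
  congr mean; apply/funext => t.
  rewrite (linear_functionalD _ _ (@product_mean_linear R d l)) ih.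
  by rewrite (linear_functional_sum _ _ (@product_mean_linear R d l)).
rewrite (linear_functionalD _ _ (@mean_linear R d n)) mean_urn_sum.
by rewrite mean_grow_sum.
Qed.

Lemma iter_children_grow_sum (R : realType) d n l (g : seq (tree d) -> R) :
  product_mean l (iter n (@children_grow_sum R d) g) =
  iter n (@urn_sum R d) (fun k => product_mean k g) l.
Proof.
elim: n g => // n ih g; rewrite iterSr ih iterSr.
by congr (iter n _ _ l); apply/funext => k; rewrite product_mean_children_grow_sum.
Qed.

Lemma children_grow_sum_map (R : realType) d (I : eqType) (F : I -> tree d)
    (s : seq I) (g : seq (tree d) -> R) : uniq s ->
  children_grow_sum g [seq F i | i <- s] =
  \sum_(i <- s) \sum_(v <- leaves (F i))
    g [seq if j == i then grow (F j) v else F j | j <- s].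
Proof.
elim: s g => [|i s ih] g /=; first by rewrite big_nil.
move=> /andP[ins us]; rewrite big_cons ih //; congr (_ + _).
  apply: eq_bigr => v _; rewrite eqxx; congr (g (_ :: _)).
  by apply/eq_in_map => j js; case: eqP => // e; move: ins; rewrite -e js.
rewrite [LHS]big_seq [RHS]big_seq; apply: eq_bigr => j js.
by case: eqP => // e; move: ins; rewrite e js.
Qed.

(** Once the root has offspring, the leaves of the tree are those of its
    branches, and growing at a leaf grows a single branch. *)
Lemma grow_sum_children (R : realType) d (tau : tree d)
    (g : seq (tree d) -> R) : [::] \notin leaves tau ->
  grow_sum (fun t => g (children t)) tau = children_grow_sum g (children tau).
Proof.
move=> nl; rewrite children_grow_sum_map ?enum_uniq //.
have p : perm_eq (leaves tau)
    [seq i :: v | i <- enum 'I_d, v <- enum_fset (leaves (child i tau))].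
  apply: uniq_perm; first exact: fset_uniq.
    apply: allpairs_uniq_dep; [exact: enum_uniq|by move=> i _; exact: fset_uniq|].
    by move=> [i v] [j w] _ _ /= [-> ->].
  move=> [|i v].
    rewrite (negPf nl); apply/esym/negbTE/allpairsPdep.
    by move=> [j [w [_ _]]].
  rewrite -leaves_child; apply/idP/allpairsPdep => [h|].
    by exists i, v; rewrite mem_enum.
  by move=> [j [w [_ h [-> ->]]]].
rewrite /grow_sum (perm_big _ p) big_allpairs_dep /=.
apply: eq_bigr => i _; apply: eq_bigr => v _; congr g.
by apply: eq_map => j; rewrite child_grow.
Qed.

Lemma iter_grow_sum_children (R : realType) d n (tau : tree d)
    (g : seq (tree d) -> R) : [::] \notin leaves tau ->
  iter n (@grow_sum R d) (fun t => g (children t)) tau =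
  iter n (@children_grow_sum R d) g (children tau).
Proof.
elim: n tau => // n ih tau nl.
rewrite !iterS -grow_sum_children //; apply: eq_bigr => v _.
by rewrite ih // root_not_leaf_grow.
Qed.

Lemma iter_grow_sum_first_step (R : realType) d n (f : tree d -> R) :
  iter n.+1 (@grow_sum R d) f (root_tree d) =
  iter n (@grow_sum R d) f (grow (root_tree d) [::]).
Proof. by rewrite iterS {1}/grow_sum leaves_root big_seq_fset1. Qed.

(** The expectation of [h] at the list of sizes of the d branches of a tree
    after [n.+1] steps, the first of which is made by the root. *)
Definition urn_mean (R : realType) d n (h : seq nat -> R) : R :=
  iter n (@urn_sum R d) h (nseq d 0%N) / (history_count d n.+1)%:R.

Lemma product_mean_nseq0 (R : realType) d k (g : seq (tree d) -> R) :
  product_mean (nseq k 0%N) g = g (nseq k (root_tree d)).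
Proof. by elim: k g => //= k ih g; rewrite mean0 ih. Qed.

(** The conditional independence of the branches given their sizes, in the form
    of a double expectation. *)
Lemma mean_children (R : realType) d n (g : seq (tree d) -> R) : (0 < d)%N ->
  mean n.+1 (fun t => g (children t)) =
  urn_mean d n (fun l => product_mean l g).
Proof.
move=> d0; rewrite /mean /urn_mean iter_grow_sum_first_step.
rewrite iter_grow_sum_children ?root_not_leaf_grow_root //.
rewrite -iter_children_grow_sum product_mean_nseq0; congr (iter n _ g _ / _).
rewrite /children; under eq_map do rewrite child_grow_root.
have E (s : seq 'I_d) : [seq root_tree d | _ <- s] = nseq (size s) (root_tree d).
  by elim: s => //= i s ->.
by rewrite E size_enum_ord.
Qed.

(** * Moments under the product law *)

Lemma product_mean_le (R : realType) d l (f g : seq (tree d) -> R) :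
  (forall y, size y = size l -> f y <= g y) ->
  product_mean l f <= product_mean l g.
Proof.
elim: l f g => [|n l ih] f g fg /=; first exact: fg.
by apply: mean_le => t; apply: ih => y sy; apply: fg; rewrite /= sy.
Qed.

Lemma product_mean_prod (R : realType) d l (f : tree d -> R) :
  product_mean l (fun y => \prod_(t <- y) f t) = \prod_(n <- l) mean n f.
Proof.
elim: l => [|n l ih] /=; first by rewrite !big_nil.
rewrite big_cons -ih mulrC -(linear_functionalZ _ _ (@mean_linear R d n)).
congr mean; apply/funext => t.
rewrite mulrC -(linear_functionalZ _ _ (@product_mean_linear R d l)).
by congr product_mean; apply/funext => y; rewrite big_cons.
Qed.

Lemma product_mean_cst (R : realType) d l (c : R) : (0 < d)%N ->
  product_mean l (fun _ : seq (tree d) => c) = c.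
Proof.
move=> d0; elim: l => //= n l ->.
rewrite -[LHS]/(mean n (fun=> c)).
have -> : (fun _ : tree d => c) = (fun t => c * (fun=> 1) t).
  by apply/funext => t; rewrite mulr1.
by rewrite (linear_functionalZ _ _ (@mean_linear R d n)) mean1 // mulr1.
Qed.

Lemma product_mean_sum (R : realType) d l (f : tree d -> R) : (0 < d)%N ->
  product_mean l (fun y => \sum_(t <- y) f t) = \sum_(n <- l) mean n f.
Proof.
move=> d0; elim: l => [|n l ih] /=; first by rewrite !big_nil.
rewrite big_cons.
transitivity (mean n (fun t => f t + (\sum_(m <- l) mean m f) * (fun=> 1) t)).
  congr mean; apply/funext => t; rewrite mulr1 -ih.
  rewrite -[X in X + _](product_mean_cst l (f t) d0).
  rewrite -(linear_functionalD _ _ (@product_mean_linear R d l)).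
  by congr product_mean; apply/funext => y; rewrite big_cons.
rewrite (linear_functionalD _ _ (@mean_linear R d n)).
by rewrite (linear_functionalZ _ _ (@mean_linear R d n)) mean1 // mulr1.
Qed.

(** Additivity of the variance. *)
Lemma product_mean_sqr_sum (R : realType) d l (f : tree d -> R) : (0 < d)%N ->
  product_mean l (fun y => (\sum_(t <- y) f t) ^+ 2) =
  (\sum_(n <- l) mean n f) ^+ 2 +
  \sum_(n <- l) (mean n (fun t => f t ^+ 2) - mean n f ^+ 2).
Proof.
move=> d0; elim: l => [|n l ih] /=; first by rewrite !big_nil addr0.
rewrite !big_cons.
set A := \sum_(m <- l) mean m f in ih *.
set B := \sum_(m <- l) _ in ih *.
transitivity (mean n (fun t => f t ^+ 2 +
   (2 * A * f t + (A ^+ 2 + B) * (fun=> 1) t))).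
  congr mean; apply/funext => t.
  rewrite mulr1 -ih /A -(product_mean_sum l f d0).
  rewrite -[X in X + (_ + _)](product_mean_cst l (f t ^+ 2) d0).
  rewrite -mulrA (mulrC _ (f t)) mulrA.
  rewrite -(linear_functionalZD _ _ _ (@product_mean_linear R d l)).
  rewrite -(linear_functionalD _ _ (@product_mean_linear R d l)).
  congr product_mean; apply/funext => y; rewrite big_cons; ring.
rewrite (linear_functionalD _ _ (@mean_linear R d n)).
rewrite (linear_functionalZD _ _ _ (@mean_linear R d n)).
rewrite (linear_functionalZ _ _ (@mean_linear R d n)) mean1 //; ring.
Qed.

Lemma sqr_mean_le (R : realType) d n (f : tree d -> R) : (0 < d)%N ->
  mean n f ^+ 2 <= mean n (fun t => f t ^+ 2).
Proof.
move=> d0; set a := mean n f.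
have : mean n (fun t => 2 * a * f t + (- a ^+ 2) * (fun=> 1) t) <=
       mean n (fun t => f t ^+ 2).
  by apply: mean_le => t /=; have := sqr_ge0 (f t - a); nra.
rewrite (linear_functionalZD _ _ _ (@mean_linear R d n)).
by rewrite (linear_functionalZ _ _ (@mean_linear R d n)) mean1 // -/a; nra.
Qed.

Lemma mean_ge0 (R : realType) d n (f : tree d -> R) :
  (forall t, 0 <= f t) -> 0 <= mean n f.
Proof.
move=> f0; rewrite -[leLHS](linear_functional0 (@mean_linear R d n)).
exact: mean_le.
Qed.

(** Both sides are sums of products of two distinct terms, which is monotone. *)
Lemma cross_terms_le (R : realType) (l : seq nat) (a s : nat -> R) :
  {in l, forall n, 0 <= a n <= s n} ->
  (\sum_(n <- l) a n) ^+ 2 - \sum_(n <- l) a n ^+ 2 <=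
  (\sum_(n <- l) s n) ^+ 2 - \sum_(n <- l) s n ^+ 2.
Proof.
elim: l => [|n l ih] h; first by rewrite !big_nil.
rewrite !big_cons.
have {}ih := ih (fun m ml => h m (mem_behead (s := n :: l) ml)).
have /andP[a0 as_] := h n (mem_head _ _).
have A0 : 0 <= \sum_(m <- l) a m.
  by rewrite big_seq; apply: sumr_ge0 => m ml; have /andP[] := h m (mem_behead (s := n :: l) ml).
have AS : \sum_(m <- l) a m <= \sum_(m <- l) s m.
  rewrite big_seq [leRHS]big_seq; apply: ler_sum => m ml.
  by have /andP[] := h m (mem_behead (s := n :: l) ml).
have : a n * \sum_(m <- l) a m <= s n * \sum_(m <- l) s m by exact: ler_pM.
by nra.
Qed.

(** The product of [s n] with the rest of the sum of [s] loses half of its value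
    when [s n] is replaced by [a n]; it occurs twice, and both
    factors are at least [m]. *)
Lemma cross_terms_gap (R : realType) (l : seq nat) (a s : nat -> R) n m :
  {in l, forall n, 0 <= a n <= s n} -> {in l, forall n, m <= s n} -> 0 <= m ->
  (1 < size l)%N -> n \in l -> a n <= s n / 2 ->
  (\sum_(n <- l) a n) ^+ 2 - \sum_(n <- l) a n ^+ 2 + m ^+ 2 <=
  (\sum_(n <- l) s n) ^+ 2 - \sum_(n <- l) s n ^+ 2.
Proof.
move=> has hm m0 sl nl an.
have p := perm_to_rem nl; rewrite !(perm_big _ p) !big_cons /=.
have sub k : k \in rem n l -> k \in l by exact: mem_rem.
have := cross_terms_le (fun k kl => has k (sub k kl)).
have : m <= \sum_(k <- rem n l) s k.
  move: sub; have := size_rem nl; case: (rem n l) => [|k r].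
    by move: sl; case: (size l) => [|[]].
  move=> _ sub; rewrite big_cons -[leLHS]addr0; apply: lerD.
    by apply/hm/sub; rewrite mem_head.
  rewrite big_seq; apply: sumr_ge0 => j jr.
  by apply: le_trans m0 (hm _ (sub _ _)); rewrite inE jr orbT.
have A0 : 0 <= \sum_(k <- rem n l) a k.
  by rewrite big_seq; apply: sumr_ge0 => k /sub /has /andP[].
have AS : \sum_(k <- rem n l) a k <= \sum_(k <- rem n l) s k.
  by rewrite big_seq [leRHS]big_seq; apply: ler_sum => k /sub /has /andP[].
have /andP[a0 _] := has n nl; have ms := hm n nl.
set A := \sum_(k <- rem n l) a k in A0 AS *.
set S := \sum_(k <- rem n l) s k in AS *.
move=> mS.
have h1 : a n * A <= s n / 2 * S by exact: ler_pM.
have h2 : m * m <= s n * S by exact: ler_pM.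
by nra.
Qed.

Lemma sum_drop_min_le (R : realType) (x : seq nat) (p : R) : x != [::] ->
  {in x, forall y, p <= y%:R} ->
  (sum_drop_min x)%:R <= \sum_(y <- x) y%:R - p.
Proof.
move=> x0 px; rewrite /sum_drop_min.
have E : (\sum_(y <- x) y%:R : R) = (sumn x)%:R by rewrite sumnE natr_sum.
have le y : y \in x -> (y <= sumn x)%N.
  by move=> yx; rewrite sumnE (big_rem y) //= leq_addr.
rewrite E big_seq; apply: (big_ind (fun n => n%:R <= (sumn x)%:R - p)).
- rewrite subr_ge0; case: x x0 px le {E} => // y x _ px le.
  by rewrite (le_trans (px y _)) ?mem_head // ler_nat le ?mem_head.
- by move=> m n mp np; rewrite /maxn; case: ifP.
- by move=> y yx; rewrite natrB ?le // lerD2l lerN2 px.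
Qed.

Lemma prod_itv01 (R : realType) (T : eqType) (y : seq T) (f : T -> R) :
  {in y, forall u, 0 <= f u <= 1} -> 0 <= \prod_(u <- y) f u <= 1.
Proof.
move=> f01; rewrite big_seq; apply/andP; split.
  by apply: prodr_ge0 => u /f01 /andP[].
by apply: prodr_ile1 => u /f01.
Qed.

Lemma prod_le_factor (R : realType) (T : eqType) (y : seq T) (f : T -> R) t :
  {in y, forall u, 0 <= f u <= 1} -> t \in y -> \prod_(u <- y) f u <= f t.
Proof.
move=> f01 ty; rewrite (big_rem t) //= -[leRHS]mulr1.
apply: ler_wpM2l; first by have /andP[] := f01 t ty.
have f01' : {in rem t y, forall u, 0 <= f u <= 1} by move=> u /mem_rem /f01.
by have /andP[] := prod_itv01 f01'.
Qed.

(** A Paley-Zygmund bound.  With Y = f / s one has min(f / m, 1) >= Y - Y^2 / 4,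
    since f / m >= Y and (Y / 2 - 1)^2 >= 0; the mean of the right-hand side is
    at least 1/4, and z^2 >= z / 2 - 1/16 passes to the square. *)
Lemma truncated_second_moment (R : realType) d n (f : tree d -> R) (s m : R) :
  (0 < d)%N -> 0 < m -> m <= s -> (forall t, 0 <= f t) ->
  s / 2 <= mean n f -> mean n (fun t => f t ^+ 2) <= s ^+ 2 ->
  16^-1 <= mean n (fun t => Num.min (f t / m) 1 ^+ 2).
Proof.
move=> d0 m0 ms f0 af bf; have s0 : 0 < s := lt_le_trans m0 ms.
have pt t : (2 * s)^-1 * f t + (- (8 * s ^+ 2)^-1 * f t ^+ 2 +
    (- 16^-1) * (fun=> 1) t) <= Num.min (f t / m) 1 ^+ 2.
  set Y := f t / s.
  have Y0 : 0 <= Y by rewrite divr_ge0 // ltW.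
  have -> : (2 * s)^-1 * f t + (- (8 * s ^+ 2)^-1 * f t ^+ 2 +
    (- 16^-1) * (fun=> 1) t) = (Y - Y ^+ 2 / 4) / 2 - 16^-1.
    by rewrite /Y; field; rewrite gt_eqF.
  have : Y - Y ^+ 2 / 4 <= Num.min (f t / m) 1.
    rewrite le_min; apply/andP; split; last by have := sqr_ge0 (Y / 2 - 1); nra.
    apply: (@le_trans _ _ Y); first by have := sqr_ge0 Y; lra.
    by rewrite ler_wpM2l // lef_pV2 ?posrE.
  by have := sqr_ge0 (Num.min (f t / m) 1 - 4^-1); nra.
apply: (le_trans _ (mean_le n pt)).
rewrite !(linear_functionalZD _ _ _ (@mean_linear R d n)).
rewrite (linear_functionalZ _ _ (@mean_linear R d n)) mean1 // mulr1.
have h1 : 4^-1 <= (2 * s)^-1 * mean n f.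
  rewrite mulrC ler_pdivlMr ?mulr_gt0 //; lra.
have h2 : (8 * s ^+ 2)^-1 * mean n (fun t => f t ^+ 2) <= 8^-1.
  rewrite mulrC ler_pdivrMr ?mulr_gt0 ?exprn_gt0 //; lra.
lra.
Qed.

(** The gain from dropping the smallest of independent variables whose L2 norms
    are at most [s n].  If some mean is at most half of [s n], the cross terms of
    the square of the sum are small.  Otherwise m times the product of the
    truncations min(X / m, 1) is a lower bound of every variable, and its second
    moment factors by independence. *)
Lemma second_moment_sum_drop_min (R : realType) d (X : tree d -> nat)
    (l : seq nat) (s : nat -> R) (m : R) :
  (0 < d)%N -> (1 < size l)%N -> 0 < m -> {in l, forall n, m <= s n} ->
  {in l, forall n, mean n (fun t => (X t)%:R ^+ 2) <= s n ^+ 2} ->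
  product_mean l (fun y => (sum_drop_min [seq X t | t <- y])%:R ^+ 2) <=
  (\sum_(n <- l) s n) ^+ 2 - m ^+ 2 / 16 ^+ size l.
Proof.
move=> d0 sl m0 ms bs.
pose x t : R := (X t)%:R.
pose a n := mean n x.
have x0 t : 0 <= x t by rewrite /x.
have s0 n : n \in l -> 0 <= s n by move=> /ms; apply: le_trans; exact: ltW.
have as_ : {in l, forall n, 0 <= a n <= s n}.
  move=> n nl; rewrite mean_ge0 //= -(ler_pXn2r (n := 2)) ?nnegrE ?mean_ge0 ?s0 //.
  exact: le_trans (sqr_mean_le n x d0) (bs n nl).
have dm0 y : 0 <= (sum_drop_min y)%:R :> R by [].
(* For 0 <= p <= S one has (S - p)^2 <= S^2 - p^2. *)
have main (p : seq (tree d) -> R) : (forall y, 0 <= p y) ->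
    (forall y t, t \in y -> p y <= x t) ->
    product_mean l (fun y => (sum_drop_min [seq X t | t <- y])%:R ^+ 2) <=
    (\sum_(n <- l) a n) ^+ 2 + \sum_(n <- l) (s n ^+ 2 - a n ^+ 2)
    - product_mean l (fun y => p y ^+ 2).
  move=> p0 px.
  have le : product_mean l (fun y => (sum_drop_min [seq X t | t <- y])%:R ^+ 2) <=
            product_mean l (fun y => -1 * p y ^+ 2 + (\sum_(t <- y) x t) ^+ 2).
    apply: product_mean_le => y sy.
    have yn : [seq X t | t <- y] != [::] by rewrite -size_eq0 size_map sy; case: (size l) sl.
    have := @sum_drop_min_le R _ (p y) yn.
    rewrite big_map => H.
    have {}H : (sum_drop_min [seq X t | t <- y])%:R <= \sum_(t <- y) x t - p y.
      by apply: H => _ /mapP[t ty ->]; exact: px.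
    have := dm0 [seq X t | t <- y]; have := p0 y.
    by nra.
  apply: (le_trans le).
  rewrite (linear_functionalZD _ _ _ (@product_mean_linear R d l)).
  rewrite mulN1r addrC lerD2r product_mean_sqr_sum // lerD2l.
  rewrite big_seq [leRHS]big_seq; apply: ler_sum => n nl.
  by rewrite lerD2r bs.
have [/hasP[n nl an]|/hasPn H] := boolP (has (fun n => a n <= s n / 2) l).
  have := @main (fun=> 0) (fun=> lexx _) (fun _ t _ => x0 t).
  have -> : (fun _ : seq (tree d) => (0 : R) ^+ 2) = (fun=> 0).
    by apply/funext => _; rewrite expr0n.
  rewrite product_mean_cst // subr0 sumrB.
  have := cross_terms_gap as_ ms (ltW m0) sl nl an.
  have : m ^+ 2 / 16 ^+ size l <= m ^+ 2.
    rewrite ler_pdivrMr ?exprn_gt0 // ler_peMr ?sqr_ge0 //.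
    by rewrite exprn_ege1 // ler1n.
  by lra.
pose xi t : R := Num.min (x t / m) 1.
have xi01 t : 0 <= xi t <= 1.
  by rewrite /xi le_min ge_min lexx orbT ler01 !andbT divr_ge0 // ltW.
have := main (fun y => m * \prod_(t <- y) xi t).
have -> : (fun y : seq (tree d) => (m * \prod_(t <- y) xi t) ^+ 2) =
          (fun y => m ^+ 2 * \prod_(t <- y) xi t ^+ 2).
  by apply/funext => y; rewrite exprMn prodrXl.
rewrite (linear_functionalZ _ _ (@product_mean_linear R d l)) product_mean_prod.
have le16 : (16 ^+ size l)^-1 <= \prod_(n <- l) mean n (fun t => xi t ^+ 2).
  have -> : (16 ^+ size l)^-1 = \prod_(n <- l) (16^-1 : R).
    by rewrite big_const_seq count_predT iter_mulr_1 exprVn.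
  rewrite big_seq [leRHS]big_seq; apply: ler_prod => n nl.
  rewrite invr_ge0 ler0n /=.
  apply: (@truncated_second_moment _ _ _ x (s n)) => //.
  - exact: ms.
  - by rewrite ltW // ltNge H.
  - exact: bs.
have := cross_terms_le as_.
have : m ^+ 2 / 16 ^+ size l <= m ^+ 2 * \prod_(n <- l) mean n (fun t => xi t ^+ 2).
  by rewrite ler_wpM2l // sqr_ge0.
move=> h1 h2 h3.
have {}h3 := h3 _ _.
apply: le_trans (h3 _ _) _.
- by move=> y; rewrite mulr_ge0 ?(ltW m0) //; have /andP[] := @prod_itv01 R _ y xi (fun u _ => xi01 u).
- move=> y t ty; rewrite mulrC -ler_pdivlMr //.
  by apply: le_trans (prod_le_factor (fun u _ => xi01 u) ty) _; rewrite /xi ge_min lexx.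
- by rewrite sumrB; lra.
Qed.

(** * The Polya urn of branch sizes *)

Lemma leaf_countS d n : leaf_count d n.+1 = (leaf_count d n + d.-1)%N.
Proof. by rewrite /leaf_count; lia. Qed.

Lemma urn_sum_linear (R : realType) d l :
  linear_functional (fun h => @urn_sum R d h l).
Proof.
move=> c f g; elim: l f g => [|n l ih] f g /=; first by rewrite mulr0 addr0.
rewrite ih; ring.
Qed.

Lemma urn_sum_le (R : realType) d (h h' : seq nat -> R) l :
  (forall k, size k = size l -> sumn k = (sumn l).+1 -> h k <= h' k) ->
  urn_sum d h l <= urn_sum d h' l.
Proof.
elim: l h h' => //= n l ih h h' hh; apply: lerD.
  by rewrite ler_wpM2l // hh.
by apply: ih => k sk kl; apply: hh; rewrite /= ?sk // kl addnS.
Qed.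

Lemma iter_urn_sum_linear (R : realType) d n l :
  linear_functional (fun h => iter n (@urn_sum R d) h l).
Proof.
move=> c f g; elim: n l => //= n ih l; rewrite -urn_sum_linear.
by congr urn_sum; apply/funext => k; rewrite ih.
Qed.

Lemma iter_urn_sum_le (R : realType) d n (h h' : seq nat -> R) l :
  (forall k, size k = size l -> sumn k = (sumn l + n)%N -> h k <= h' k) ->
  iter n (@urn_sum R d) h l <= iter n (@urn_sum R d) h' l.
Proof.
elim: n l => [|n ih] l hh /=; first by apply: hh; rewrite ?addn0.
apply: urn_sum_le => k sk kl; apply: ih => j sj jk.
by apply: hh; rewrite ?sj // jk kl addSnnS.
Qed.

Lemma urn_mean_linear (R : realType) d n : linear_functional (@urn_mean R d n).
Proof.
by move=> c f g; rewrite /urn_mean iter_urn_sum_linear mulrDl mulrA.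
Qed.

Lemma urn_mean_le (R : realType) d n (h h' : seq nat -> R) :
  (forall k, size k = d -> sumn k = n -> h k <= h' k) ->
  urn_mean d n h <= urn_mean d n h'.
Proof.
move=> hh; rewrite ler_pM2r ?invr_gt0 ?ltr0n ?history_count_gt0 //.
apply: iter_urn_sum_le => k; rewrite size_nseq sumn_nseq mul0n; exact: hh.
Qed.

Lemma urn_mean_cst (R : realType) d n (c : R) : (0 < d)%N ->
  urn_mean d n (fun=> c) = c.
Proof.
move=> d0; have := @mean_children R d n (fun=> c) d0.
have -> : (fun l => product_mean l (fun _ : seq (tree d) => c)) = (fun=> c).
  by apply/funext => l; rewrite product_mean_cst.
move=> <-; exact: (product_mean_cst [:: n.+1] c d0).
Qed.

Definition leaf_prod (R : realType) d (l : seq nat) : R :=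
  \prod_(n <- l) (leaf_count d n)%:R.

(** The product of the numbers of leaves is multiplied by a factor that depends
    only on the time: a step of the k-th branch multiplies the product by
    1 + (d - 1) / l_k and has weight l_k. *)
Lemma urn_sum_leaf_prod (R : realType) d l :
  urn_sum d (@leaf_prod R d) l =
  leaf_prod R d l * (size l + d.-1 * (sumn l + size l))%:R.
Proof.
elim: l => [|n l ih] /=; first by rewrite muln0 mulr0.
have -> : (fun k => leaf_prod R d (n :: k)) =
    (fun k => (leaf_count d n)%:R * leaf_prod R d k).
  by apply/funext => k; rewrite /leaf_prod big_cons.
rewrite (linear_functionalZ _ _ (@urn_sum_linear R d l)) ih.
rewrite /leaf_prod !big_cons leaf_countS natrD.
have -> : ((size l).+1 + d.-1 * (n + sumn l + (size l).+1))%N =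
  (leaf_count d n + d.-1 + (size l + d.-1 * (sumn l + size l)))%N.
  by rewrite /leaf_count; lia.
rewrite !natrD; ring.
Qed.

Lemma iter_urn_sum_leaf_prod (R : realType) d n l :
  iter n (@urn_sum R d) (@leaf_prod R d) l =
  leaf_prod R d l *
  \prod_(i < n) (size l + d.-1 * (sumn l + i + size l))%:R.
Proof.
elim: n l => [|n ih] l /=; first by rewrite big_ord0 mulr1.
set c : R := \prod_(i < n) (size l + d.-1 * (sumn l + i.+1 + size l))%:R.
transitivity (urn_sum d (fun k => c * leaf_prod R d k) l).
  have E k : size k = size l -> sumn k = (sumn l).+1 ->
      iter n (@urn_sum R d) (@leaf_prod R d) k = c * leaf_prod R d k.
    move=> sk kl; rewrite ih sk kl mulrC; congr (_ * _).
    by apply: eq_bigr => i _; rewrite addSnnS.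
  by apply: le_anti; apply/andP; split; apply: urn_sum_le => k sk kl; rewrite E.
rewrite (linear_functionalZ _ _ (@urn_sum_linear R d l)) urn_sum_leaf_prod.
by rewrite big_ord_recl /= addn0 -/c; ring.
Qed.

Lemma history_countD d m n :
  history_count d (m + n) =
  (history_count d m * \prod_(i < n) leaf_count d (m + i))%N.
Proof. by rewrite /history_count big_split_ord. Qed.

(** The factors of [iter_urn_sum_leaf_prod] telescope against [history_count]. *)
Lemma urn_mean_leaf_prod_ge (R : realType) d n : (0 < d)%N ->
  (leaf_count d n.+1)%:R ^+ d / (history_count d d.+1)%:R <=
  urn_mean d n (@leaf_prod R d).
Proof.
move=> d0; rewrite /urn_mean iter_urn_sum_leaf_prod size_nseq sumn_nseq mul0n.
have -> : leaf_prod R d (nseq d 0%N) = 1.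
  by rewrite /leaf_prod big_nseq /leaf_count muln0 iter_mulr_1 expr1n.
have -> : \prod_(i < n) (d + d.-1 * (0 + i + d))%:R =
    (\prod_(i < n) leaf_count d (d.+1 + i))%:R :> R.
  rewrite natr_prod; apply: eq_bigr => i _; congr _%:R.
  by rewrite /leaf_count; nia.
rewrite mul1r ler_pdivrMr ?ltr0n ?history_count_gt0 //.
rewrite mulrAC ler_pdivlMr ?ltr0n ?history_count_gt0 //.
rewrite -natrX -!natrM ler_nat [leqRHS]mulnC -history_countD.
have -> : (d.+1 + n = n.+1 + d)%N by rewrite addSnnS addnC.
rewrite history_countD mulnC leq_mul2l; apply/orP; right.
have -> : (leaf_count d n.+1 ^ d = \prod_(i < d) leaf_count d n.+1)%N.
  by rewrite prod_nat_const card_ord.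
apply: leq_prod => i _.
by rewrite ltnS leq_mul2l leq_addr orbT.
Qed.

(** * The second moment of the largest avoiding set *)

(** The concave function y |-> y^delta lies below its tangent at 1.  The proof
    combines two instances of 1 + u <= exp u. *)
Lemma powR_le_tangent (R : realType) (y delta : R) :
  0 < y -> 0 <= delta <= 1 -> y `^ delta <= delta * y + (1 - delta).
Proof.
move=> y0 /andP[d0 d1]; rewrite /powR gt_eqF // -{2}(lnK y0).
set x := ln y; set E := expR (delta * x).
have E0 : 0 < E by exact: expR_gt0.
have h1 : E * (1 + (1 - delta) * x) <= expR x.
  have -> : expR x = E * expR ((1 - delta) * x).
    by rewrite -expRD; congr expR; ring.
  by rewrite ler_pM2l // expR_ge1Dx.
have h2 : E * (1 - delta * x) <= 1.
  have e : E * expR (- (delta * x)) = 1 by rewrite -expRD subrr expR0.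
  by rewrite -[leRHS]e ler_pM2l // expR_ge1Dx.
have : delta * (E * (1 + (1 - delta) * x)) <= delta * expR x by exact: ler_wpM2l.
have : (1 - delta) * (E * (1 - delta * x)) <= (1 - delta) * 1.
  by apply: ler_wpM2l => //; rewrite subr_ge0.
by lra.
Qed.

Lemma sumn_ge (l : seq nat) k : k \in l -> (k <= sumn l)%N.
Proof. by move=> kl; rewrite sumnE (big_rem k) //= leq_addr. Qed.

Lemma sum_leaf_count d l :
  (\sum_(k <- l) leaf_count d k = size l + d.-1 * sumn l)%N.
Proof.
elim: l => [|k l ih] /=; first by rewrite big_nil muln0.
by rewrite big_cons ih /leaf_count; lia.
Qed.

(** The induction described at the top.  The constant g is the relative gain of
    [second_moment_sum_drop_min] in mean; delta is chosen so close to 1 that the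
    sum of y_k^delta over relative sizes y_k is at most 1 + g / 6, and eta = g / 4
    absorbs the root, through (1 + z)^2 <= (1 + eta) z^2 + 1 + 1 / eta. *)
Lemma largest_avoiding_second_moment (R : realType) d : (1 < d)%N ->
  exists delta K : R, [/\ 0 < delta, delta < 1, 0 < K &
    forall n, @mean R d n (fun t => (largest_avoiding t)%:R ^+ 2) <=
              (K * (leaf_count d n)%:R `^ delta) ^+ 2].
Proof.
move=> d1; have d0 : (0 < d)%N by exact: ltnW.
(* c bounds from below the mean of the product of the relative sizes. *)
pose c : R := (history_count d d.+1)%:R^-1.
have c0 : 0 < c by rewrite invr_gt0 ltr0n history_count_gt0.
have c1 : c <= 1 by rewrite invf_le1 ?ltr0n ?history_count_gt0 // ler1n history_count_gt0.
pose q : R := (16 ^+ d)^-1.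
have q0 : 0 < q by rewrite invr_gt0 exprn_gt0.
have q1 : q <= 1 by rewrite invf_le1 ?exprn_gt0 // exprn_ege1 // ler1n.
pose g : R := c ^+ 2 * q.
have g0 : 0 < g by rewrite mulr_gt0 ?exprn_gt0.
have g1 : g <= 1 by rewrite mulr_ile1 ?exprn_ile1 ?exprn_ge0 // ltW.
(* The tangent bound gives sum_k y_k^delta <= delta + d (1 - delta). *)
pose delta : R := 1 - g / (6 * d%:R).
have dR : 1 <= d%:R :> R by rewrite ler1n.
have dd : (1 - delta) * d%:R = g / 6.
  rewrite /delta; field; lra.
have dl1 : delta < 1 by nra.
have dl0 : 0 < delta by nra.
pose eta := g / 4.
have e0 : 0 < eta by rewrite /eta; lra.
pose K := 1 + eta^-1.
have ei : 0 < eta^-1 by rewrite invr_gt0.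
have K0 : 0 < K by rewrite /K; lra.
exists delta, K; split=> //.
pose X (t : tree d) := largest_avoiding t.
elim/ltn_ind => -[_|n IH].
  rewrite mean0 /leaf_count muln0 powR1 mulr1.
  have h : (largest_avoiding (root_tree d))%:R <= 1 :> R.
    by rewrite lern1 largest_avoiding_root.
  rewrite ler_pXn2r ?nnegrE ?(ltW K0) //; apply: (le_trans h).
  by rewrite /K; lra.
set L : R := (leaf_count d n.+1)%:R.
have L1 : 1 <= L by rewrite ler1n.
have L0 : 0 < L by lra.
set B := L `^ delta.
have B1 : 1 <= B.
  have <- : 1 `^ delta = 1 :> R by rewrite powR1.
  by rewrite ge0_ler_powR ?nnegrE ?(ltW dl0) // ltW.
have B0 : 0 < B by lra.
pose s k : R := K * (leaf_count d k)%:R `^ delta.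
pose Phi (y : seq (tree d)) : R :=
  (1 + eta) * (sum_drop_min [seq X t | t <- y])%:R ^+ 2 + (fun=> (1 + eta^-1)) y.
have step1 : mean n.+1 (fun t => (X t)%:R ^+ 2) <= mean n.+1 (fun t => Phi (children t)).
  apply: mean_le => t; rewrite /Phi.
  have : (X t)%:R <= 1 + (sum_drop_min [seq X t' | t' <- children t])%:R :> R.
    by rewrite -(natrD _ 1) ler_nat largest_avoiding_children.
  set z := (sum_drop_min _)%:R; set x := (X t)%:R => xz.
  have x0 : 0 <= x by rewrite /x.
  have z0 : 0 <= z by rewrite /z.
  have : x ^+ 2 <= (1 + z) ^+ 2 by rewrite ler_pXn2r ?nnegrE //; lra.
  have : 0 <= eta * (z - eta^-1) ^+ 2 by rewrite mulr_ge0 ?sqr_ge0 // ltW.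
  have -> : eta * (z - eta^-1) ^+ 2 = eta * z ^+ 2 - 2 * z + eta^-1.
    by field; rewrite gt_eqF.
  by lra.
apply: (le_trans step1); rewrite mean_children //.
(* Since p^2 >= 2 c p - c^2, the gain may be taken affine in the product p of
   the relative sizes, so that only the mean of p is required. *)
pose A1 := - ((1 + eta) * (K * B) ^+ 2 * (2 * c) * q).
pose A0 := (1 + eta) * (K * B) ^+ 2 * ((1 + g / 6) ^+ 2 + c ^+ 2 * q) + (1 + eta^-1).
have step2 : urn_mean d n (fun l => product_mean l Phi) <=
  urn_mean d n (fun l => A1 * L ^- d * leaf_prod R d l + (fun=> A0) l).
  apply: urn_mean_le => l sl kl.
  have sumL : \sum_(k <- l) (leaf_count d k)%:R = L :> R.
    by rewrite -natr_sum sum_leaf_count sl kl /L /leaf_count mulnS -addSn prednK.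
  have kL : {in l, forall k, 0 < (leaf_count d k)%:R / L <= 1}.
    move=> k k_l; rewrite divr_gt0 ?ltr0n //= ler_pdivrMr // mul1r.
    by rewrite ler_nat /leaf_count ltnS leq_mul2l -kl ltnW ?orbT // ltnS sumn_ge.
  pose p := \prod_(k <- l) ((leaf_count d k)%:R / L).
  have pE : p = L ^- d * leaf_prod R d l.
    by rewrite /p big_split /= mulrC big_const_seq count_predT sl iter_mulr_1 exprVn.
  have p0 : 0 < p.
    by rewrite /p big_seq; apply: prodr_gt0 => k /kL /andP[].
  rewrite -mulrA -pE.
  rewrite (linear_functionalZD _ _ _ (@product_mean_linear R d l)) product_mean_cst //.
  have sE k : s k = K * B * ((leaf_count d k)%:R / L) `^ delta.
    by rewrite /s /B -mulrA -powRM ?divr_ge0 ?(ltW L0) // [L * _]mulrC divfK ?gt_eqF.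
  (* The product of the relative sizes is at most each of them, hence at most
     its power with exponent delta. *)
  have ms : {in l, forall k, K * B * p <= s k}.
    move=> k k_l; rewrite sE ler_wpM2l ?mulr_ge0 ?(ltW K0) ?(ltW B0) //.
    have /andP[y0 y1] := kL k k_l.
    apply: (@le_trans _ _ ((leaf_count d k)%:R / L)).
      by apply: (prod_le_factor (f := fun k => (leaf_count d k)%:R / L)) => // u /kL /andP[/ltW -> ->].
    by rewrite -[leLHS]powRr1 ?(ltW y0) // ger_powR ?y0 // ltW.
  have bs : {in l, forall k, mean k (fun t : tree d => (X t)%:R ^+ 2) <= s k ^+ 2}.
    by move=> k k_l; apply: IH; rewrite ltnS -kl sumn_ge.
  have m0 : 0 < K * B * p by rewrite !mulr_gt0.
  have sl1 : (1 < size l)%N by rewrite sl.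
  have := second_moment_sum_drop_min d0 sl1 m0 ms bs; rewrite sl -/q.
  have : \sum_(k <- l) s k <= K * B * (1 + g / 6).
    under eq_bigr do rewrite sE.
    rewrite -big_distrr /= ler_wpM2l ?mulr_ge0 ?(ltW K0) ?(ltW B0) //.
    apply: (@le_trans _ _ (\sum_(k <- l) (delta * ((leaf_count d k)%:R / L) + (1 - delta)))).
      rewrite big_seq [leRHS]big_seq; apply: ler_sum => k /kL /andP[y0 _].
      by apply: powR_le_tangent; rewrite // ltW // ltW.
    rewrite big_split /= -big_distrr -big_distrl /= sumL divff ?gt_eqF // mulr1.
    by rewrite big_const_seq count_predT sl iter_addr_0 -[_ *+ d]mulr_natr dd; lra.
  have : 0 <= \sum_(k <- l) s k.
    by apply: sumr_ge0 => k _; rewrite mulr_ge0 ?(ltW K0) // powR_ge0.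
  set S := \sum_(k <- l) s k; set M := product_mean _ _ => S0 S1 MS.
  have S2 : S ^+ 2 <= (K * B) ^+ 2 * (1 + g / 6) ^+ 2.
    by rewrite -exprMn ler_pXn2r ?nnegrE //; exact: le_trans S1.
  have p2 : 2 * c * p - c ^+ 2 <= p ^+ 2 by have := sqr_ge0 (p - c); lra.
  have : (K * B) ^+ 2 * q * (2 * c * p - c ^+ 2) <= (K * B) ^+ 2 * q * p ^+ 2.
    by rewrite ler_wpM2l // mulr_ge0 ?exprn_ge0 ?ltW // mulr_gt0.
  move=> h.
  have : M <= (K * B) ^+ 2 * ((1 + g / 6) ^+ 2 + c ^+ 2 * q) - (K * B) ^+ 2 * (2 * c) * q * p.
    by rewrite -/q exprMn in MS; lra.
  have e1 : 0 <= 1 + eta by lra.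
  move=> /(ler_wpM2l e1); rewrite /A1 /A0; lra.
apply: (le_trans step2).
rewrite (linear_functionalZD _ _ _ (@urn_mean_linear R d n)) urn_mean_cst //.
have A1L : A1 * L ^- d * urn_mean d n (leaf_prod R d) <= A1 * c.
  rewrite -mulrA ler_wnM2l //.
    by rewrite oppr_le0 !mulr_ge0 ?exprn_ge0 ?ltW ?mulr_gt0 //; lra.
  by rewrite mulrC ler_pdivlMr ?exprn_gt0 // mulrC; exact: urn_mean_leaf_prod_ge.
have KB : (1 + eta^-1) <= eta * (K * B) ^+ 2.
  have -> : 1 + eta^-1 = eta * (K * eta^-1) by rewrite mulrCA divff ?gt_eqF // mulr1.
  rewrite ler_pM2l // exprMn expr2 -mulrA ler_pM2l //.
  have B2 : 1 <= B ^+ 2 by rewrite exprn_ege1.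
  have : K * 1 <= K * B ^+ 2 by rewrite ler_pM2l.
  by rewrite /K; lra.
have main : (1 + eta) * ((1 + g / 6) ^+ 2 - g) <= 1 - eta by rewrite /eta; nra.
have : (K * B) ^+ 2 * ((1 + eta) * ((1 + g / 6) ^+ 2 - g)) <= (K * B) ^+ 2 * (1 - eta).
  by rewrite ler_wpM2l // sqr_ge0.
by rewrite /A0 /g /A1 in A1L *; lra.
Qed.

(** * The law of the process *)

(** The transition operator of the process. *)
Definition grow_average (R : realType) d (f : tree d -> R) (tau : tree d) : R :=
  grow_sum f tau / (#|` leaves tau|)%:R.

(** The number of leaves is deterministic, so normalising step by step or once at
    the end is the same. *)
Lemma iter_grow_sum_average (R : realType) d n (f : tree d -> R) tau :
  (0 < d)%N -> prefix_closed tau -> (0 < #|` leaves tau|)%N ->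
  iter n (@grow_sum R d) f tau =
    (\prod_(s < n) (#|` leaves tau| + d.-1 * s)%:R) *
    iter n (@grow_average R d) f tau.
Proof.
move=> d0; elim: n tau => [|n ih] tau pc l0; first by rewrite big_ord0 mul1r.
rewrite !iterS /grow_average {1 3}/grow_sum big_seq.
under eq_bigr => v vt.
  have cl := card_leaves_grow d0 pc vt.
  rewrite ih; [|exact: prefix_closed_grow|by rewrite cl ltn_addr].
  under eq_bigr do rewrite cl -addnA -mulnS.
  over.
rewrite -big_seq -big_distrr big_ord_recl /= muln0 addn0.
by field; rewrite pnatr_eq0 -lt0n.
Qed.

Lemma mean_average (R : realType) d n (f : tree d -> R) : (0 < d)%N ->
  mean n f = iter n (@grow_average R d) f (root_tree d).
Proof.
move=> d0; rewrite /mean iter_grow_sum_average //; last 2 first.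
- exact: prefix_closed_root.
- by rewrite leaves_root cardfs1.
have -> : \prod_(s < n) (#|` leaves (root_tree d)| + d.-1 * s)%:R =
    (history_count d n)%:R :> R.
  by rewrite /history_count natr_prod leaves_root cardfs1.
by rewrite mulrAC divff ?mul1r // pnatr_eq0 -lt0n history_count_gt0.
Qed.

Lemma iter_grow_average_ge0 (R : realType) d n (f : tree d -> R) tau :
  (forall t, 0 <= f t) -> 0 <= iter n (@grow_average R d) f tau.
Proof.
move=> f0; elim: n tau => //= n ih tau.
by rewrite divr_ge0 // sumr_ge0.
Qed.

Section Process.
Context (R : realType) (d : nat) (d0 : (0 < d)%N).
Context (disp : measure_display) (Omega : measurableType disp).
Context (P : probability Omega R).
Context (Tr : nat -> Omega -> tree d) (V : nat -> Omega -> vertex d).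
Hypothesis proc : recursive_tree_process P Tr V.

Lemma measurable_tree_event t (A : set (tree d)) :
  measurable [set w | A (Tr t w)].
Proof.
have -> : [set w | A (Tr t w)] = \bigcup_n
    (if (choice.unpickle n : option (tree d)) is Some tau
     then [set w | Tr t w = tau /\ A tau] else set0).
  apply/seteqP; split=> w /=.
    by move=> Aw; exists (choice.pickle (Tr t w)) => //; rewrite choice.pickleK.
  by move=> [n _]; case: choice.unpickle => // tau /= [->].
apply: bigcup_measurable => n _; case: choice.unpickle => [tau|]; last exact: measurable0.
have [At|At] := pselect (A tau).
  rewrite (_ : [set w | _] = [set w | Tr t w = tau]); first exact: (tree_measurable proc).
  by apply/seteqP; split=> w //= [].
rewrite (_ : [set w | _] = set0); first exact: measurable0.
by apply/seteqP; split=> w //= [].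
Qed.

Let past t (tau : nat -> tree d) := [set w | forall s, (s <= t)%N -> Tr s w = tau s].

Lemma measurable_past t tau : measurable (past t tau).
Proof.
have -> : past t tau = \bigcap_(s in [set s | (s <= t)%N]) [set w | Tr s w = tau s].
  by apply/seteqP; split.
by apply: bigcap_measurableType => s _; exact: (tree_measurable proc).
Qed.

(** A tree history up to time [t] continued by the pick [v]. *)
Definition extend t (tau : nat -> tree d) (v : vertex d) s : tree d :=
  if (s <= t)%N then tau s else grow (tau t) v.

Lemma past_extend t tau v : v \in leaves (tau t) ->
  past t.+1 (extend t tau v) = past t tau `&` [set w | V t w = v].
Proof.
move=> vl; apply/seteqP; split=> w /=.
  move=> h; have hp : past t tau w.
    by move=> s st; rewrite h ?(leqW st) // /extend st.
  split=> //; have := h t.+1 (leqnn _).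
  rewrite (tree_step proc) hp // /extend ltnn.
  by apply: grow_inj => //; rewrite -(hp t (leqnn _)); exact: (pick_leaf proc).
move=> [hp Vv] s; rewrite leq_eqVlt ltnS /extend => /predU1P[->|st].
  by rewrite ltnn (tree_step proc) hp // Vv.
by rewrite st hp.
Qed.

(** The Markov property, by decomposing a past according to the next pick; each
    piece is a past one step longer. *)
Lemma law_after_past (A : set (tree d)) k t tau :
  P (past t tau `&` [set w | A (Tr (t + k) w)]) =
  (P (past t tau) *
   (iter k (@grow_average R d) (fun x => (`[< A x >])%:R) (tau t))%:E)%E.
Proof.
elim: k t tau => [|k ih] t tau.
  rewrite addn0 /=; case: asboolP => At.
    rewrite mule1; congr (P _); apply/seteqP; split=> w /=; first by case.
    by move=> h; split=> //; rewrite h.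
  rewrite mule0 -(measure0 P); congr (P _); apply/seteqP; split=> w //=.
  by move=> [h]; rewrite h.
have -> : past t tau `&` [set w | A (Tr (t + k.+1) w)] =
    \bigcup_(v in [set` enum_fset (leaves (tau t))])
      (past t.+1 (extend t tau v) `&` [set w | A (Tr (t.+1 + k) w)]).
  rewrite addSnnS; apply/seteqP; split=> w /=.
    move=> [h Aw]; have Vl : V t w \in leaves (tau t).
      by rewrite -(h t (leqnn _)); exact: (pick_leaf proc).
    by exists (V t w) => //; split => //; rewrite past_extend.
  by move=> [v vl]; rewrite past_extend // => -[[]].
rewrite measure_fin_bigcup //; last 2 first.
- move=> u v /= ul vl [w [[]]]; rewrite !past_extend //.
  by move=> [_ /= <-] _ [[_ /= <-]].
- by move=> v _; apply: measurableI; [exact: measurable_past|exact: measurable_tree_event].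
rewrite -(fsbig_seq _ _ (fset_uniq _)) big_seq.
transitivity (\sum_(v <- leaves (tau t) | v \in leaves (tau t))
    (P (past t tau) * ((#|` leaves (tau t)|%:R)^-1 *
       iter k (@grow_average R d) (fun x => (`[< A x >])%:R)
         (grow (tau t) v))%:E))%E.
  apply: eq_bigr => v vl; apply: etrans (ih t.+1 (extend t tau v)) _.
  by rewrite past_extend // (pick_uniform proc) // /extend ltnn -muleA -EFinM.
rewrite -big_seq -ge0_sume_distrr.
  rewrite sumEFin; congr (_ * _%:E)%E.
  by rewrite -big_distrr /= mulrC.
move=> v _; rewrite lee_fin mulr_ge0 ?invr_ge0 //.
exact: iter_grow_average_ge0.
Qed.

Lemma law_mean t (A : set (tree d)) :
  P [set w | A (Tr t w)] = (mean t (fun x => (`[< A x >])%:R))%:E.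
Proof.
rewrite mean_average //.
have pT : past 0 (fun=> root_tree d) = setT.
  by apply/seteqP; split=> w //= _ s; rewrite leqn0 => /eqP ->; exact: (tree_initial proc).
have := law_after_past A t 0 (fun=> root_tree d).
by rewrite pT setTI probability_setT mul1e.
Qed.

Lemma markov_sqr t (f : tree d -> R) (lambda : R) : 0 < lambda ->
  (P [set w | (lambda <= f (Tr t w))%R] <=
    (mean t (fun x => f x ^+ 2) / lambda ^+ 2)%:E)%E.
Proof.
move=> l0; rewrite (law_mean t (fun x => lambda <= f x)) lee_fin mulrC.
rewrite -(linear_functionalZ _ _ (@mean_linear R d t)); apply: mean_le => x.
rewrite mulrC; case: asboolP => h; last by rewrite divr_ge0 ?sqr_ge0.
by rewrite ler_pdivlMr ?exprn_gt0 // mul1r ler_pXn2r ?nnegrE ?(ltW l0) // (le_trans (ltW l0)).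
Qed.

Lemma tree_mono w s t : (s <= t)%N -> (Tr s w `<=` Tr t w)%fset.
Proof.
move=> /subnK <-; elim: (t - s)%N => [|k ih]; first exact: fsubset_refl.
by rewrite addSn (tree_step proc) (fsubset_trans ih) // fsubsetUl.
Qed.

End Process.

(** * From moments to almost sure bounds *)

(** The random time is the supremum of k + 1 over the failing indices k, which is
    finite outside the upper limit of the failures. *)
Lemma occurs_eventually_lim_sup (R : realType) (disp : measure_display)
    (Omega : measurableType disp) (P : probability Omega R)
    (A : nat -> set Omega) :
  (forall k, measurable (A k)) -> P (lim_sup_set (fun k => ~` A k)) = 0%E ->
  occurs_eventually P A.
Proof.
move=> mA A0.
pose h (k : nat) (w : Omega) : \bar R := (k.+1%:R * \1_(~` A k) w)%:E.
have h0 k w : (0 <= h k w)%E by rewrite lee_fin mulr_ge0.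
exists (fun w => esups (h^~ w) 0%N); split.
- apply: measurable_fun_esups => k; apply/measurable_EFinP.
  apply: measurable_funM; first exact: measurable_cst.
  by apply: measurable_indic; exact: measurableC.
- exists (lim_sup_set (fun k => ~` A k)); split=> //.
    apply: bigcap_measurable => // k _.
    by apply: bigcup_measurable => j _; exact: measurableC.
  move=> w /=; apply: contra_notP => /existsNP[n] nA.
  have {}nA k : (n <= k)%N -> A k w.
    move=> nk; apply: contrapT => Akw; apply: nA => _.
    by exists k.
  have le : (esups (h^~ w) 0%N <= n%:R%:E)%E.
    apply: ge_ereal_sup => _ [k _ <-]; rewrite /h lee_fin indicE.
    have [nk|kn] := leqP n k.
      by rewrite memNset ?mulr0 //= => /(_ (nA k nk)).
    case: (_ \in _); rewrite ?mulr0 ?mulr1 //.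
    by rewrite ler_nat.
  rewrite ge0_fin_numE; first exact: le_lt_trans le (ltry _).
  by apply: le_trans (h0 0%N w) _; apply: ereal_sup_ubound; exists 0%N.
- move=> k w le; apply: contrapT => Akw.
  have : (h k w <= k%:R%:E)%E.
    by apply: le_trans le; apply: ereal_sup_ubound; exists k.
  by rewrite /h lee_fin indicE mem_set //= mulr1 ler_nat ltnn.
Qed.

Lemma nneseries_geometric_lty (R : realType) (a z : R) (u : (\bar R)^nat) :
  0 <= z < 1 -> (forall n, 0 <= u n)%E ->
  (forall n, u n <= (a * z ^+ n)%:E)%E -> (\sum_(n <oo) u n < +oo)%E.
Proof.
move=> /andP[z0 z1] u0 ua.
apply: (@le_lt_trans _ _ (\sum_(n <oo) (a * z ^+ n)%:E)%E).
  by apply: lee_nneseries => // n _ _; exact: ua.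
have z1' : `|z| < 1 by rewrite ger0_norm.
have -> : (\sum_(n <oo) (a * z ^+ n)%:E)%E = (a / (1 - z))%:E.
  apply: cvg_lim => //; apply: cvg_EFin.
    by apply: nearW => n; rewrite sumEFin.
  rewrite (_ : _ \o _ = series (geometric a z)).
    exact: cvg_geometric_series.
  by apply/funext => n /=; rewrite sumEFin.
exact: ltry.
Qed.

Lemma leaf_count_le d n : (0 < d)%N -> (0 < n)%N -> (leaf_count d n <= d * n)%N.
Proof. by case: d => // d _; case: n => // n _; rewrite /leaf_count /=; lia. Qed.

Lemma exists_dyadic_block j n : (2 ^ n <= j)%N ->
  exists k, [/\ (n <= k)%N, (2 ^ k <= j)%N & (j <= 2 ^ k.+1)%N].
Proof.
move=> nj; have j0 : (0 < j)%N by apply: leq_trans nj; rewrite expn_gt0.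
exists (trunc_log 2 j); have /andP[h1 h2] := trunc_log_bounds (isT : (1 < 2)%N) j0.
by split; [exact: trunc_log_max|exact: h1|exact: ltnW].
Qed.

Lemma dyadic_ratio (R : realType) (delta delta' : R) k :
  (2 ^+ k) `^ delta / (2 ^+ k) `^ delta' = (2 `^ (delta - delta')) ^+ k.
Proof.
have T0 : 0 < 2 ^+ k :> R by rewrite exprn_gt0.
rewrite -powRN -powRD; last by rewrite (gt_eqF T0) implybT.
rewrite -powR_mulrn ?ler0n // powRAC powR_mulrn // powR_ge0.
Qed.

Theorem theorem1p1 (R : realType) (d r : nat)
    (hd : (1 < d)%N) (hr : (0 < r)%N) (hrd : (r < d)%N) :
  exists delta : R, delta < 1 /\
    forall (disp : measure_display) (Omega : measurableType disp)
      (P : probability Omega R)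
      (Tr : nat -> Omega -> tree d) (V : nat -> Omega -> vertex d),
      recursive_tree_process P Tr V ->
      occurs_eventually P (fun t : nat =>
        [set w : Omega |
          (largest_r_ary r (Tr t w))%:R < (t%:R : R) `^ delta]).
Proof.
have d0 : (0 < d)%N := ltnW hd.
have [delta [K [dl0 dl1 K0 moment]]] := largest_avoiding_second_moment R hd.
pose delta' := (1 + delta) / 2; exists delta'.
have dl' : delta < delta' < 1 by rewrite /delta'; apply/andP; split; lra.
have /andP[dld dl1'] := dl'; split=> // disp Omega P Tr V proc.
(* Any failure at a time in [2^k, 2^k.+1] entails the event B k. *)
pose B k := [set w | ((2 ^+ k : R) `^ delta' <=
  (largest_r_ary r (Tr (2 ^ k.+1)%N w))%:R)%R].
have mB k : measurable (B k).
  exact: (measurable_tree_event proc _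
    [set tau | ((2 ^+ k : R) `^ delta' <= (largest_r_ary r tau)%:R)%R]).
have mA t : measurable [set w | (largest_r_ary r (Tr t w))%:R < (t%:R : R) `^ delta'].
  exact: (measurable_tree_event proc _
    [set tau | (largest_r_ary r tau)%:R < (t%:R : R) `^ delta']).
have B0 : P (lim_sup_set B) = 0%E.
  apply: lim_sup_set_cvg0 => //.
  pose z : R := 2 `^ (delta - delta').
  have z0 : 0 <= z by exact: powR_ge0.
  have z1 : z < 1.
    rewrite /z /powR gt_eqF // expR_lt1 pmulr_llt0 ?subr_lt0 //.
    by rewrite ln_gt0 // ltr1n.
  apply: (@nneseries_geometric_lty _ ((K * (2 * d%:R) `^ delta) ^+ 2) (z ^+ 2)).
  - by rewrite sqr_ge0 exprn_ilt1.
  - by move=> n; exact: measure_ge0.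
  move=> k; set T : R := 2 ^+ k.
  have T0 : 0 < T by rewrite exprn_gt0.
  have l0 : 0 < T `^ delta' by exact: powR_gt0.
  have := markov_sqr d0 proc (2 ^ k.+1)%N (fun t => (largest_avoiding t)%:R) l0.
  move=> h.
  apply: le_trans (le_trans h _).
    apply: le_measure; rewrite ?inE //.
      exact: (measurable_tree_event proc _
        [set tau | (T `^ delta' <= (largest_avoiding tau)%:R)%R]).
    move=> w /= /le_trans; apply; rewrite ler_nat.
    exact: largest_r_ary_le_avoiding.
  rewrite lee_fin exprAC -exprMn -dyadic_ratio -/T.
  rewrite mulrA expr_div_n ler_pM2r ?invr_gt0 ?exprn_gt0 //.
  apply: le_trans (moment _) _.
  have lT : (leaf_count d (2 ^ k.+1))%:R <= 2 * d%:R * T.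
    have -> : 2 * d%:R * T = (d * 2 ^ k.+1)%:R by rewrite natrM natrX exprS /T; ring.
    by rewrite ler_nat leaf_count_le // expn_gt0.
  rewrite ler_pXn2r ?nnegrE ?mulr_ge0 ?powR_ge0 ?(ltW K0) //.
  rewrite -mulrA ler_pM2l // -powRM ?mulr_ge0 ?(ltW T0) //.
  by rewrite ge0_ler_powR ?nnegrE ?(ltW dl0) ?mulr_ge0 ?(ltW T0).
apply: occurs_eventually_lim_sup => //.
apply/eqP; rewrite -measure_le0 -B0; apply: le_measure; rewrite ?inE.
- apply: bigcap_measurable => // n _.
  by apply: bigcup_measurable => j _; exact: measurableC.
- apply: bigcap_measurable => // n _.
  by apply: bigcup_measurable => j _.
move=> w bad n _; have [j /= nj /negP] := bad (2 ^ n)%N I.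
rewrite -leNgt => jS; have [k [nk kj jk]] := exists_dyadic_block nj.
exists k => //=; apply: le_trans (le_trans jS _).
  rewrite ge0_ler_powR ?nnegrE ?exprn_ge0 //; first by lra.
  by rewrite -natrX ler_nat.
by rewrite ler_nat; apply: largest_r_ary_mono; exact: (tree_mono proc).
Qed.
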